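(* Let $b$ be a graph over $(X,m)$, $q:X\to\mathbb{R}$, and let $h$ be the associated form. Assume $h\ge w$ on $C_c(X)$ with $w:X\to[0,\infty)$. Let $g:X\to[0,\infty)$ be a bounded function for which there is a constant $0<\gamma<1$ such that $$|\nabla g^{1/2}|^2\le\gamma\, g\,w\qquad\text{on }X.$$ Let $f\in C(X)$ be supported in $\operatorname{supp}w=\{x\in X: w(x)>0\}$. Let $u$ be either (a) an approximable function $u\in\mathcal{F}$ that is a solution of $\mathcal{H}u=f$ or a positive subsolution (i.e. $u\ge0$ and $\mathcal{H}u\le f$), or (b) a solution $u\in D(H)$ of $\mathcal{H}u=f$, where in this case $q\in V$ is assumed. Then $$(1-\gamma)^2\sum_{x\in X}|u(x)|^2g(x)w(x)m(x)\le\sum_{x\in X}|f(x)|^2g(x)w(x)^{-1}m(x),$$ where the summand on the right is read as $0$ where $f=0$.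
   Context: $X$ is an infinite countable set, $m:X\to(0,\infty)$, and a graph $b$ over $(X,m)$ is a symmetric function $b:X\times X\to[0,\infty)$ with zero diagonal and $\sum_{y}b(x,y)<\infty$ for all $x$. $C(X)$ is the space of real functions on $X$, $C_c(X)$ those with finite support. For $f\in C(X)$, $|\nabla f|^2(x)=\frac{1}{2m(x)}\sum_{y}b(x,y)(f(x)-f(y))^2\in[0,\infty]$. For $q:X\to\mathbb{R}$, $h(\varphi)=h_{b,q}(\varphi)=\sum_{X}(|\nabla\varphi|^2+q\varphi^2)m$ for $\varphi\in C_c(X)$. ''$h\ge w$ on $C_c(X)$'' means $h(\varphi)\ge\sum_X w\varphi^2m$ for all $\varphi\in C_c(X)$. Then $h$ is bounded below and closable on $\ell^2(X,m)$; its closure is again denoted $h$, with domain $D(h)$, and $H$ is the associated self-adjoint operator with domain $D(H)$. $H$ is a restriction of the formal operator $\mathcal{H}f(x)=\frac1{m(x)}\sum_y b(x,y)(f(x)-f(y))+q(x)f(x)$, defined on $\mathcal{F}=\{f\in C(X):\sum_y b(x,y)|f(y)|<\infty\ \forall x\in X\}$. $V$ is the set of $q\in C(X)$, $q=q_+-q_-$ (positive and negative parts), such that for some $\varepsilon>0,C>0$: $\sum_X q_-\varphi^2m\le(1-\varepsilon)h_{b,q_+}(\varphi)+C\sum_X\varphi^2m$ for all $\varphi\in C_c(X)$. A function $u\in\mathcal{F}$ is approximable if there is a sequence $(\varphi_n)$ in $C_c(X)$ with $0\le\varphi_n\nearrow1$ pointwise and $\lim_{n\to\infty}\sum_Xu^2|\nabla\varphi_n|^2m=0$.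 *)

(* Defs.v *)
From HB Require Import structures.
From mathcomp Require Export all_boot all_order all_algebra.
From mathcomp Require Export all_classical all_reals all_analysis.
Export Order.TTheory GRing.Theory Num.Theory.
Export numFieldNormedType.Exports.

Set Implicit Arguments.
Unset Strict Implicit.
Unset Printing Implicit Defensive.

Local Open Scope classical_set_scope.
Local Open Scope ring_scope.

(* Unordered sum of a real family. It is meaningful for absolutely summable
   families only ([fine] sends infinite values to 0). *)
Definition asum (R : realType) (X : choiceType) (F : X -> R) : R :=
  fine (\esum_(x in [set: X]) (F^\+ x)%:E)
  - fine (\esum_(x in [set: X]) (F^\- x)%:E).

Record is_graph (R : realType) (X : choiceType) (b : X -> X -> R) : Prop :=
  IsGraph {
    graph_ge0 : forall x y, 0 <= b x y;
    graph_sym : forall x y, b x y = b y x;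
    graph_diag : forall x, b x x = 0;
    graph_summable : forall x, (\esum_(y in [set: X]) (b x y)%:E < +oo)%E
  }.

Section Graphs.
Variables (R : realType) (X : choiceType).
Variables (m : X -> R) (b : X -> X -> R).
Implicit Types (q f g u v w phi psi : X -> R).

(* C_c(X) *)
Definition Cc : set (X -> R) := [set phi | finite_set [set x | phi x != 0]].

(* |\nabla f|^2, with values in [0, +oo] *)
Definition grad2 f (x : X) : \bar R :=
  (((2 * m x)^-1)%:E
   * (\esum_(y in [set: X]) (b x y * (f x - f y) ^+ 2)%:E))%E.

(* h_{b,q}; on C_c(X) the function grad2 phi is finite and all the sums
   converge absolutely. *)
Definition form q phi : R :=
  asum (fun x => (fine (grad2 phi x) + q x * phi x ^+ 2) * m x).

(* The symmetric bilinear form of the quadratic form [form q]. *)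
Definition bform q phi psi : R :=
  (form q (phi \+ psi) - form q (phi \- psi)) / 4.

(* h >= w on C_c(X) *)
Definition form_ge q w : Prop :=
  forall phi, Cc phi -> asum (fun x => w x * phi x ^+ 2 * m x) <= form q phi.

(* The domain of the formal operator. *)
Definition formal_dom : set (X -> R) :=
  [set f | forall x,
     (\esum_(y in [set: X]) (b x y * `|f y|)%:E < +oo)%E].

(* Meaningful on [formal_dom], where the sum converges absolutely. *)
Definition formal_op q f (x : X) : R :=
  (m x)^-1 * asum (fun y => b x y * (f x - f y)) + q x * f x.

Definition solution q u f : Prop :=
  formal_dom u /\ forall x, formal_op q u x = f x.

Definition pos_subsolution q u f : Prop :=
  [/\ formal_dom u, (forall x, 0 <= u x) & forall x, formal_op q u x <= f x].

Definition approximable u : Prop :=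
  formal_dom u /\
  exists phi : nat -> X -> R,
    [/\ (forall n, Cc (phi n)),
        (forall n x, 0 <= phi n x),
        (forall n x, phi n x <= phi n.+1 x),
        (forall x, phi n x @[n --> \oo] --> (1 : R)) &
        (\esum_(x in [set: X]) ((u x ^+ 2)%:E * grad2 (phi n) x * (m x)%:E))%E
          @[n --> \oo] --> 0%E].

(* The class V of potentials. *)
Definition classV : set (X -> R) :=
  [set q | exists eps C : R,
     [/\ 0 < eps, 0 < C &
      forall phi, Cc phi ->
        asum (fun x => q^\- x * phi x ^+ 2 * m x)
          <= (1 - eps) * form q^\+ phi
             + C * asum (fun x => phi x ^+ 2 * m x)]].

(* Square of the norm of l^2(X, m). *)
Definition l2norm2 u : \bar R :=
  \esum_(x in [set: X]) (u x ^+ 2 * m x)%:E.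

Definition l2 : set (X -> R) := [set u | (l2norm2 u < +oo)%E].

Definition l2dot u v : R := asum (fun x => u x * v x * m x).

(* [phi] is a sequence in C_c(X) that is Cauchy for the form and converges to u
   in l^2(X, m). *)
Definition form_approx q (phi : nat -> X -> R) u : Prop :=
  [/\ forall n, Cc (phi n),
      l2norm2 (phi n \- u) @[n --> \oo] --> 0%E &
      forall e : R, 0 < e ->
        \forall n \near (\oo, \oo), `|form q (phi n.1 \- phi n.2)| < e].

(* D(h), the domain of the closure of the form on l^2(X, m). *)
Definition form_dom q : set (X -> R) :=
  [set u | l2 u /\ exists phi : nat -> X -> R, form_approx q phi u].

(* The closure of the form, as a bilinear form on D(h). For a closable form that
   is bounded below, the limit exists and does not depend on the approximating
   sequences. *)
Definition closed_form q u v : R :=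
  get [set l : R | exists phi psi : nat -> X -> R,
    [/\ form_approx q phi u, form_approx q psi v &
        bform q (phi n) (psi n) @[n --> \oo] --> l]].

(* D(H), the domain of the self-adjoint operator H of the closed form: there is
   an element (namely H u) of l^2(X, m) which represents the functional
   h(u, -) on D(h). *)
Definition op_dom q : set (X -> R) :=
  [set u | form_dom q u /\
     exists2 Hu, l2 Hu &
       forall v, form_dom q v -> closed_form q u v = l2dot Hu v].

End Graphs.

Arguments Cc {R X}.

(* Main.v *)
Require Import Defs.
From mathcomp Require Import finmap ring lra summability.

(* On a finitely supported [phi] the form is a finite quadratic form, and the
   ground state identity bounds [h(u psi)] by
     [\sum u psi^2 (H u) m + \sum u^2 |grad psi|^2 m].
   Testing [h >= w] with [psi = phi g^(1/2)], where the gradient of [psi] splits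
   into [phi |grad g^(1/2)|] (absorbed by [gamma g w]) and [g^(1/2) |grad phi|],
   gives for [psi_n = u phi_n]
     [c \sum psi_n^2 g w m <= \sum f psi_n phi_n g m + o(1)] for [c < 1 - gamma],
   and Young's inequality on the right-hand side concludes.
   In case (b) the same estimate holds for any [phi_n] in [C_c(X)] that
   approximate [u] in the form norm: multiplication by [g] is bounded in the form
   norm because [q] is in [V], so [h(phi_n, g phi_n)] is close to
   [h(phi_k, g phi_n)], which tends to [\sum f g phi_n m] as [k] grows. Only
   [u] in [D(h)] is needed for this, not closability of [h]. *)

Set Implicit Arguments.
Unset Strict Implicit.
Unset Printing Implicit Defensive.

Local Open Scope classical_set_scope.
Local Open Scope ring_scope.

#[local] Existing Instance totally_filter.

(** * Unconditional sums *)

Section FiniteSubsets.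
Variable X : choiceType.

Lemma near_totally_superset (A : {fset X}) :
  \forall B \near totally, (A `<=` B)%fset.
Proof. by exists A. Qed.

End FiniteSubsets.

Section HasSum.
Variables (R : realType) (X : choiceType).
Implicit Types (F G : X -> R) (S T : R) (A B : {fset X}).

(** Convergence of the finite partial sums along the finite subsets directed by inclusion. Limits of
    this net obey the usual algebra, which spares splitting families into positive and negative
    parts. *)
Definition has_sum F S :=
  (fun A : {fset X} => \sum_(x <- A) F x) @ totally --> S.

Lemma has_sum_unique F S T : has_sum F S -> has_sum F T -> S = T.
Proof. move=> FS FT; exact: (cvg_unique _ FS FT). Qed.

Lemma has_sumD F G S T :
  has_sum F S -> has_sum G T -> has_sum (fun x => F x + G x) (S + T).
Proof.
move=> FS GT; rewrite /has_sum.
under eq_fun do rewrite big_split/=.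
exact: cvgD.
Qed.

Lemma has_sumZ F S c : has_sum F S -> has_sum (fun x => c * F x) (c * S).
Proof.
move=> FS; rewrite /has_sum.
under eq_fun do rewrite -mulr_sumr.
exact: cvgMl_tmp.
Qed.

Lemma has_sumB F G S T :
  has_sum F S -> has_sum G T -> has_sum (fun x => F x - G x) (S - T).
Proof.
move=> FS GT; rewrite /has_sum.
under eq_fun do rewrite sumrB/=.
exact: cvgB.
Qed.

Lemma has_sum_sum (I : eqType) (r : seq I) (F : I -> X -> R) (S : I -> R) :
  (forall i, i \in r -> has_sum (F i) (S i)) ->
  has_sum (fun x => \sum_(i <- r) F i x) (\sum_(i <- r) S i).
Proof.
elim: r => [|i r ih] Fr.
  rewrite /has_sum big_nil.
  under eq_fun => A do under eq_bigr do rewrite big_nil.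
  under eq_fun do rewrite big1//.
  exact: cvg_cst.
rewrite big_cons /has_sum.
under eq_fun => A do under eq_bigr do rewrite big_cons.
apply: has_sumD; first by apply: Fr; rewrite mem_head.
by apply: ih => j jr; apply: Fr; rewrite in_cons jr orbT.
Qed.

Lemma sum_supp (V : nmodType) (F : X -> V) A B : (A `<=` B)%fset ->
  (forall x, x \notin A -> F x = 0) -> \sum_(x <- B) F x = \sum_(x <- A) F x.
Proof.
move=> AB F0; rewrite (big_fset_incl _ AB)// => x _ xA; exact: F0.
Qed.

Lemma has_sum_supp F A :
  (forall x, x \notin A -> F x = 0) -> has_sum F (\sum_(x <- A) F x).
Proof.
move=> F0; apply: cvg_near_cst.
near=> B; apply: sum_supp => //; near: B; exact: near_totally_superset.
Unshelve. all: by end_near. Qed.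

Lemma sum_le_esum (a : X -> \bar R) A :
  (\sum_(x <- A) a x <= \esum_(x in [set: X]) a x)%E.
Proof.
by apply: esum_ge; exists [set` A] => //; rewrite fsbig_finite//= set_fsetK.
Qed.

Lemma esum_le (a : X -> \bar R) c : (forall A, (\sum_(x <- A) a x <= c)%E) ->
  (\esum_(x in [set: X]) a x <= c)%E.
Proof.
move=> ac; apply: ge_ereal_sup => _ [D [finD _] <-].
by rewrite fsbig_finite//=.
Qed.

Lemma le_sum_subset F A B : (forall x, 0 <= F x) -> (A `<=` B)%fset ->
  \sum_(x <- A) F x <= \sum_(x <- B) F x.
Proof.
move=> F0 AB; rewrite (big_fsetID _ [in A] B)/=.
have -> : [fset x in B | x \in A]%fset = A.
  apply/fsetP => x; rewrite !inE/= andbC.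
  by case: (boolP (x \in A)) => //= /(fsubsetP AB).
by rewrite lerDl sumr_ge0.
Qed.

(** Partial sums of a nonnegative family increase with the finite set, so one finite set whose sum
    is within [e] of the supremum controls all larger ones. *)
Lemma has_sum_nneg F S : (forall x, 0 <= F x) ->
  \esum_(x in [set: X]) (F x)%:E = S%:E -> has_sum F S.
Proof.
move=> F0 FS; apply/cvgrPdist_le => e e0.
have [A AS] : exists A, S - e <= \sum_(x <- A) F x.
  apply: contrapT => /forallNP H.
  have : (\esum_(x in [set: X]) (F x)%:E <= (S - e)%:E)%E.
    apply: esum_le => A; rewrite sumEFin lee_fin.
    by have /negP := H A; rewrite -ltNge => /ltW.
  by rewrite FS lee_fin; lra.
near=> B.
have AB : (A `<=` B)%fset by near: B; exact: near_totally_superset.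
have : (\sum_(x <- B) (F x)%:E <= S%:E)%E by rewrite -FS; exact: sum_le_esum.
rewrite sumEFin lee_fin => BS.
have := le_sum_subset F0 AB.
by rewrite ger0_norm; lra.
Unshelve. all: by end_near. Qed.

Lemma cvg_le (I : Type) (D : set_system I) {PD : ProperFilter D} (a c : I -> R) S T :
  a x @[x --> D] --> S -> c x @[x --> D] --> T ->
  (\forall x \near D, a x <= c x) -> S <= T.
Proof.
move=> aS cT ac; rewrite -subr_ge0.
have caTS : (fun x => c x - a x) @ D --> T - S by exact: cvgB.
rewrite -(cvg_lim (@Rhausdorff R) caTS); apply: limr_ge.
  by apply/cvg_ex; exists (T - S).
by apply: filterS ac => x; rewrite /= subr_ge0.
Qed.

Lemma sum_le_has_sum F S A : (forall x, 0 <= F x) -> has_sum F S ->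
  \sum_(x <- A) F x <= S.
Proof.
move=> F0 FS; apply: (cvg_le (cvg_cst _) FS).
near=> B; apply: le_sum_subset => //; near: B; exact: near_totally_superset.
Unshelve. all: by end_near. Qed.

Lemma has_sum_ge0 F S : (forall x, 0 <= F x) -> has_sum F S -> 0 <= S.
Proof. by move=> F0 /(sum_le_has_sum fset0 F0); rewrite big_seq_fset0. Qed.

Lemma esum_has_sum F S : (forall x, 0 <= F x) -> has_sum F S ->
  \esum_(x in [set: X]) (F x)%:E = S%:E.
Proof.
move=> F0 FS.
have FT : (\esum_(x in [set: X]) (F x)%:E <= S%:E)%E.
  by apply: esum_le => A; rewrite sumEFin lee_fin sum_le_has_sum.
have /fineK FE : \esum_(x in [set: X]) (F x)%:E \is a fin_num.
  rewrite ge0_fin_numE ?(le_lt_trans FT) ?ltry//.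
  by apply: esum_ge0 => x _; rewrite lee_fin.
rewrite -FE; congr EFin; apply: (has_sum_unique _ FS).
exact: has_sum_nneg.
Qed.

Lemma has_sum_fine F : (forall x, 0 <= F x) ->
  (\esum_(x in [set: X]) (F x)%:E < +oo)%E ->
  has_sum F (fine (\esum_(x in [set: X]) (F x)%:E)).
Proof.
move=> F0 Foo; apply: has_sum_nneg => //; rewrite fineK// ge0_fin_numE//.
by apply: esum_ge0 => x _; rewrite lee_fin.
Qed.

Lemma has_sum_asum F : (\esum_(x in [set: X]) `|F x|%:E < +oo)%E ->
  has_sum F (asum F).
Proof.
move=> Foo.
have H (G : X -> R) : (forall x, G x <= `|F x|) -> (forall x, 0 <= G x) ->
    has_sum G (fine (\esum_(x in [set: X]) (G x)%:E)).
  move=> GF G0; apply: has_sum_fine => //; apply: le_lt_trans Foo.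
  by apply: le_esum => x _; rewrite lee_fin.
rewrite [X in has_sum X](_ : F = fun x => F^\+ x - F^\- x); last first.
  by apply/funext => x; rewrite -{1}(funrposBneg F).
have FE x : F^\+ x + F^\- x = `|F x|.
  by have /(congr1 (fun h => h x)) := funrposDneg F.
apply: has_sumB; apply: H => x; rewrite ?funrpos_ge0 ?funrneg_ge0// -FE.
  by rewrite lerDl funrneg_ge0.
by rewrite lerDr funrpos_ge0.
Qed.

(** Domination by a summable [G] keeps the sums of the positive and negative parts finite, so that
    [fine] in [asum] discards nothing. *)
Lemma asum_has_sum F G S T : (forall x, `|F x| <= G x) -> has_sum G T ->
  has_sum F S -> asum F = S.
Proof.
move=> FG GT FS; apply: (has_sum_unique _ FS); apply: has_sum_asum.
have := esum_has_sum (fun x => le_trans (normr_ge0 _) (FG x)) GT.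
move=> {}GT; apply: (@le_lt_trans _ _ T%:E); rewrite ?ltry// -GT.
by apply: le_esum => x _; rewrite lee_fin.
Qed.

Lemma asum_supp F A : (forall x, x \notin A -> F x = 0) ->
  asum F = \sum_(x <- A) F x.
Proof.
move=> F0; apply: (@asum_has_sum F (fun x => `|F x|) _ (\sum_(x <- A) `|F x|)) => //.
  by apply: has_sum_supp => x /F0 ->; rewrite normr0.
exact: has_sum_supp.
Qed.

End HasSum.

(** * The form on finitely supported functions *)

Section QuadraticForm.
Variables (R : realType) (X : choiceType) (m : X -> R) (b : X -> X -> R).
Hypotheses (m_gt0 : forall x, 0 < m x) (graph_b : is_graph b).
Implicit Types (q w u v f phi psi G : X -> R) (A B : {fset X}).

Let b_ge0 := graph_ge0 graph_b.
Let b_sym := graph_sym graph_b.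

Definition deg x : R := fine (\esum_(y in [set: X]) (b x y)%:E).

Lemma has_sum_deg x : has_sum (b x) (deg x).
Proof. by apply: has_sum_fine => //; exact: graph_summable. Qed.

Lemma deg_ge0 x : 0 <= deg x.
Proof. exact: (has_sum_ge0 _ (@has_sum_deg x)). Qed.

(** The diagonal entry of the formal operator multiplied by [m x]; this normalization keeps the
    quadratic form free of divisions. *)
Definition diag_coef q x : R := deg x + q x * m x.

(** The energy with its squares expanded: edges leaving [A] survive only in the degree inside
    [diag_coef]. It is bilinear by construction and so serves as the polar form of [form] on
    functions supported in [A]. *)
Definition form_on q A phi psi : R :=
  \sum_(x <- A) diag_coef q x * phi x * psi x
  - \sum_(x <- A) \sum_(y <- A) b x y * phi x * psi y.

Definition supported A phi := forall x, x \notin A -> phi x = 0.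

Lemma Cc_supported phi : Cc phi -> exists A, supported A phi.
Proof.
move=> Cphi; exists (fset_set [set x | phi x != 0]) => x.
by apply: contraNeq => phix; rewrite in_fset_set// mem_set.
Qed.

Lemma supported_Cc A phi : supported A phi -> Cc phi.
Proof.
move=> sA; apply: (@sub_finite_set _ _ [set` A]) => // x /= phix.
by apply/negPn/negP => /sA/eqP; apply/negP.
Qed.

Lemma supported_sub A B phi : (A `<=` B)%fset -> supported A phi -> supported B phi.
Proof. by move=> AB sA x xB; apply: sA; apply: contraNN xB; exact: fsubsetP. Qed.

Lemma has_sum_sqdiff A phi x : supported A phi ->
  has_sum (fun y => b x y * (phi x - phi y) ^+ 2)
    (phi x ^+ 2 * deg x
     + \sum_(y <- A) b x y * (phi y ^+ 2 - 2 * phi x * phi y)).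
Proof.
move=> sA.
rewrite [X in has_sum X](_ : _ = fun y => phi x ^+ 2 * b x y
    + b x y * (phi y ^+ 2 - 2 * phi x * phi y)); last first.
  by apply/funext => y; ring.
apply: has_sumD; first by apply: has_sumZ; exact: has_sum_deg.
by apply: has_sum_supp => y /sA ->; ring.
Qed.

Lemma grad2_has_sum f x S : has_sum (fun y => b x y * (f x - f y) ^+ 2) S ->
  grad2 m b f x = ((2 * m x)^-1 * S)%:E.
Proof.
move=> fS; rewrite /grad2 (esum_has_sum _ fS)// => y.
by rewrite mulr_ge0// sqr_ge0.
Qed.

Lemma grad2_supp A phi x : supported A phi ->
  fine (grad2 m b phi x) * m x = 2^-1 * (phi x ^+ 2 * deg x
     + \sum_(y <- A) b x y * (phi y ^+ 2 - 2 * phi x * phi y)).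
Proof.
move=> sA; rewrite (grad2_has_sum (has_sum_sqdiff sA))/=.
by field; rewrite gt_eqF.
Qed.

Lemma has_sum_grad2 A phi : supported A phi ->
  has_sum (fun x => fine (grad2 m b phi x) * m x) (form_on (fun=> 0) A phi phi).
Proof.
move=> sA.
(* The gradient does not vanish off [A]. Its tail [2^-1 * \sum_(y <- A) phi y ^+ 2 * b x y] is split
   off; summed over all [x], it yields the degrees [deg y] by symmetry of [b]. The rest is supported
   in [A]. *)
rewrite [X in has_sum X](_ : _ = fun x =>
  (2^-1 * (phi x ^+ 2 * deg x) - \sum_(y <- A) b x y * phi x * phi y)
  + 2^-1 * \sum_(y <- A) phi y ^+ 2 * b x y); last first.
  apply/funext => x; rewrite (grad2_supp _ sA) !mulrDr -!addrA; congr (_ + _).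
  rewrite !mulr_sumr -sumrN -big_split/=; apply: eq_bigr => y _.
  by field.
rewrite [X in has_sum _ X](_ : _ =
  \sum_(x <- A) (2^-1 * (phi x ^+ 2 * deg x) - \sum_(y <- A) b x y * phi x * phi y)
  + 2^-1 * \sum_(y <- A) phi y ^+ 2 * deg y); last first.
  rewrite /form_on sumrB mulr_sumr addrAC -big_split/=; congr (_ - _).
  by apply: eq_bigr => x _; rewrite /diag_coef; field.
apply: has_sumD.
  apply: has_sum_supp => x /sA ->; rewrite expr0n/= mul0r mulr0 big1 ?subr0//.
  by move=> y _; ring.
apply/has_sumZ/has_sum_sum => y _; apply: has_sumZ.
rewrite [X in has_sum X](_ : _ = b y); first exact: has_sum_deg.
by apply/funext => x; exact: b_sym.
Qed.

Lemma form_supp q A phi : supported A phi -> form m b q phi = form_on q A phi phi.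
Proof.
move=> sA; have g2 := has_sum_grad2 sA.
have qphi0 x : x \notin A -> q x * phi x ^+ 2 * m x = 0 by move/sA ->; ring.
have qphi := has_sum_supp qphi0.
have qphi' : has_sum (fun x => `|q x * phi x ^+ 2 * m x|)
    (\sum_(x <- A) `|q x * phi x ^+ 2 * m x|).
  by apply: has_sum_supp => x /qphi0 ->; rewrite normr0.
have grad2_ge0 x : 0 <= fine (grad2 m b phi x) * m x.
  apply: mulr_ge0; last exact: ltW.
  apply: fine_ge0; apply: mule_ge0; first by rewrite lee_fin invr_ge0 mulr_ge0// ltW.
  by apply: esum_ge0 => y _; rewrite lee_fin mulr_ge0 ?sqr_ge0.
rewrite /form; apply: (asum_has_sum _ (has_sumD g2 qphi')) => [x|].
  by rewrite mulrDl (le_trans (ler_normD _ _))// lerD// ger0_norm.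
rewrite [X in has_sum X](_ : _ = fun x =>
    fine (grad2 m b phi x) * m x + q x * phi x ^+ 2 * m x).
  rewrite [X in has_sum _ X](_ : _ =
    form_on (fun=> 0) A phi phi + \sum_(x <- A) q x * phi x ^+ 2 * m x).
    exact: has_sumD.
  rewrite /form_on addrAC -big_split/=; congr (_ - _).
  by apply: eq_bigr => x _; rewrite /diag_coef; ring.
by apply/funext => x; rewrite mulrDl.
Qed.

End QuadraticForm.

(** * The ground state identity *)

Section GroundState.
Variables (R : realType) (X : choiceType) (m : X -> R) (b : X -> X -> R).
Hypotheses (m_gt0 : forall x, 0 < m x) (graph_b : is_graph b).
Implicit Types (q w u v f phi psi G : X -> R) (A B : {fset X}).

Let b_ge0 := graph_ge0 graph_b.
Let b_sym := graph_sym graph_b.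

Local Notation quad := (form_on m b).
Local Notation diag := (diag_coef m b).

(** The formal operator times [m], with the sum of differences split into degree and neighbour sum;
    [formal_opE] makes the link on the formal domain. *)
Definition laplace q v x : R := diag q x * v x - asum (fun y => b x y * v y).

Lemma formal_dom_has_sum v x : formal_dom b v ->
  has_sum (fun y => b x y * v y) (asum (fun y => b x y * v y)).
Proof.
move=> /(_ x) vx; apply: has_sum_asum; apply: le_lt_trans vx.
by apply: le_esum => y _; rewrite normrM ger0_norm.
Qed.

Lemma formal_opE q v x : formal_dom b v -> m x * formal_op m b q v x = laplace q v x.
Proof.
move=> vdom; have bv := formal_dom_has_sum (x:=x) vdom.
have deg_x := has_sum_deg graph_b (x:=x).
have absv : has_sum (fun y => b x y * `|v y|) (asum (fun y => b x y * `|v y|)).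
  apply: formal_dom_has_sum => z; under eq_esum do rewrite normr_id.
  exact: vdom.
rewrite /formal_op (@asum_has_sum _ _ _ (fun y => `|v x| * b x y + b x y * `|v y|)
  (v x * deg b x - asum (fun y => b x y * v y))
  (`|v x| * deg b x + asum (fun y => b x y * `|v y|))).
- rewrite /laplace /diag_coef; field; exact: lt0r_neq0.
- move=> y; rewrite normrM ger0_norm// (mulrC `|v x|) -mulrDr ler_wpM2l//.
  exact: ler_normB.
- by apply: has_sumD => //; exact: has_sumZ.
- rewrite [X in has_sum X](_ : _ = fun y => v x * b x y - b x y * v y).
    by apply: has_sumB => //; exact: has_sumZ.
  by apply/funext => y; ring.
Qed.

Lemma sum_swap A (F : X -> X -> R) :
  \sum_(x <- A) \sum_(y <- A) F x y = \sum_(x <- A) \sum_(y <- A) F y x.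
Proof. exact: exchange_big. Qed.

Lemma quad_sym q A phi psi : quad q A phi psi = quad q A psi phi.
Proof.
rewrite /form_on [X in _ - X]sum_swap; congr (_ - _).
  by apply: eq_bigr => x _; ring.
by apply: eq_bigr => x _; apply: eq_bigr => y _; rewrite b_sym; ring.
Qed.

(** Green's formula: the support of [phi] reduces the neighbour sum in [laplace q phi] to [A], while
    [psi] may be arbitrary. *)
Lemma quad_laplace q A phi psi : supported A phi ->
  quad q A phi psi = \sum_(x <- A) psi x * laplace q phi x.
Proof.
move=> sA; rewrite quad_sym /form_on -sumrB; apply: eq_bigr => x _.
rewrite /laplace (@asum_supp _ _ (fun y => b x y * phi y) A); last first.
  by move=> y /sA ->; rewrite mulr0.
rewrite mulrBr mulr_sumr; congr (_ - _); first by ring.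
by apply: eq_bigr => y _; ring.
Qed.

(** Adding the sum to itself with [x] and [y] exchanged turns the bracket into
    [(psi x - psi y) ^+ 2]; then [v x * v y] is at most the mean of the squares. *)
Lemma symmetrized_le A v psi :
  \sum_(x <- A) \sum_(y <- A) b x y * v x * v y * (psi x ^+ 2 - psi x * psi y)
  <= 2^-1 * \sum_(x <- A) v x ^+ 2 * \sum_(y <- A) b x y * (psi x - psi y) ^+ 2.
Proof.
set S := (X in X <= _); set E := (X in _ <= _ * X).
suff : S + S <= E by lra.
rewrite {2}/S sum_swap -big_split/=.
under eq_bigr do rewrite -big_split/=.
have -> : E = \sum_(x <- A) \sum_(y <- A)
    2^-1 * (b x y * (v x ^+ 2 + v y ^+ 2) * (psi x - psi y) ^+ 2).
  have {1}-> : E = 2^-1 * (E + E) by field.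
  rewrite {2}/E /E; under [X in _ * (_ + X)]eq_bigr do rewrite mulr_sumr.
  rewrite [X in _ * (_ + X)]sum_swap -big_split/= mulr_sumr; apply: eq_bigr => x _.
  rewrite mulr_sumr -big_split/= mulr_sumr; apply: eq_bigr => y _.
  by rewrite (b_sym y x); ring.
apply: ler_sum => x _; apply: ler_sum => y _.
rewrite (b_sym y x).
have -> : b x y * v x * v y * (psi x ^+ 2 - psi x * psi y) +
    b x y * v y * v x * (psi y ^+ 2 - psi y * psi x) =
    b x y * (psi x - psi y) ^+ 2 * (v x * v y) by ring.
have -> : 2^-1 * (b x y * (v x ^+ 2 + v y ^+ 2) * (psi x - psi y) ^+ 2) =
    b x y * (psi x - psi y) ^+ 2 * (2^-1 * (v x ^+ 2 + v y ^+ 2)) by ring.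
apply: ler_wpM2l; first by rewrite mulr_ge0 ?sqr_ge0.
rewrite -subr_ge0 (_ : _ - _ = 2^-1 * (v x - v y) ^+ 2); last by field.
by rewrite mulr_ge0 ?sqr_ge0 ?invr_ge0.
Qed.

(** The diagonal terms of the two forms cancel, and the off-diagonal difference is exactly the
    left-hand side of [symmetrized_le]. *)
Lemma quad_mul_fin q A v psi :
  quad q A (v \* psi) (v \* psi) <= quad q A v (psi \* psi \* v)
  + 2^-1 * \sum_(x <- A) v x ^+ 2 * \sum_(y <- A) b x y * (psi x - psi y) ^+ 2.
Proof.
apply: le_trans (lerD (lexx _) (symmetrized_le _ _ _)).
rewrite [in leRHS]quad_sym /form_on -addrA lerD//.
  by rewrite le_eqVlt; apply/orP; left; apply/eqP; apply: eq_bigr => x _ /=; ring.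
rewrite -subr_ge0 le_eqVlt; apply/orP; left; apply/eqP.
rewrite -!sumrN -!big_split/= big1// => x _.
rewrite -!sumrN -!big_split/= big1// => y _; ring.
Qed.

(** The ground state inequality when [v] has infinite support. Only the finitely many neighbour sums
    at [x] in [A] are infinite; they are limits over finite sets [B], whence the bound [T] uniform
    in [B]. *)
Lemma quad_mul_le q A v psi T : formal_dom b v -> supported A psi ->
  (forall B, (A `<=` B)%fset ->
     2^-1 * (\sum_(x <- B) v x ^+ 2 * \sum_(y <- B) b x y * (psi x - psi y) ^+ 2) <= T) ->
  quad q A (v \* psi) (v \* psi) <= \sum_(x <- A) v x * psi x ^+ 2 * laplace q v x + T.
Proof.
move=> vdom sA BT.
pose bv x := asum (fun y => b x y * v y).
suff : \sum_(x <- A) v x * psi x ^+ 2 * bv x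
       - \sum_(x <- A) \sum_(y <- A) b x y * (v x * psi x) * (v y * psi y) <= T.
  rewrite /form_on /laplace -/(bv _).
  have -> : \sum_(x <- A) v x * psi x ^+ 2 * (diag q x * v x - bv x) =
    \sum_(x <- A) diag q x * (v \* psi) x * (v \* psi) x
    - \sum_(x <- A) v x * psi x ^+ 2 * bv x.
    by rewrite -sumrB; apply: eq_bigr => x _ /=; ring.
  by lra.
have cv : has_sum (fun y => \sum_(x <- A) v x * psi x ^+ 2 * (b x y * v y))
    (\sum_(x <- A) v x * psi x ^+ 2 * bv x).
  by apply: has_sum_sum => x _; apply: has_sumZ; exact: formal_dom_has_sum.
rewrite lerBlDr; apply: (cvg_le cv (cvg_cst _)).
near=> B.
have AB : (A `<=` B)%fset by near: B; exact: near_totally_superset.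
rewrite -lerBlDr; apply: le_trans (BT _ AB); apply: le_trans (symmetrized_le _ _ _).
(* Sums carrying a factor [psi] extend from [A] to [B] unchanged, so both variables range over [B]
   and [symmetrized_le] applies there. *)
rewrite [X in _ - X](_ : _ =
    \sum_(x <- A) \sum_(y <- B) b x y * (v x * psi x) * (v y * psi y)); last first.
  by apply: eq_bigr => x _; rewrite [RHS](sum_supp AB)// => y /sA ->; rewrite !mulr0.
rewrite [leRHS](sum_supp AB); last first.
  by move=> x /sA ->; rewrite big1// => y _; ring.
rewrite exchange_big/= -sumrB le_eqVlt; apply/orP; left; apply/eqP.
apply: eq_bigr => x _; rewrite -sumrB; apply: eq_bigr => y _; ring.
Unshelve. all: by end_near. Qed.

End GroundState.

(** * The weighted inequality *)

Section Rellich.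
Variables (R : realType) (X : choiceType) (m : X -> R) (b : X -> X -> R).
Hypotheses (m_gt0 : forall x, 0 < m x) (graph_b : is_graph b).
Implicit Types (u v f phi psi : X -> R) (A B : {fset X}).
Variables (q w : X -> R).
Hypotheses (w_ge0 : forall x, 0 <= w x) (h_ge_w : form_ge m b q w).

Let b_ge0 := graph_ge0 graph_b.

Local Notation quad := (form_on m b).

Lemma hardy_quad A phi : supported A phi ->
  \sum_(x <- A) w x * phi x ^+ 2 * m x <= quad q A phi phi.
Proof.
move=> sA; have := h_ge_w (supported_Cc sA).
by rewrite (form_supp m_gt0 graph_b _ sA) (@asum_supp _ _ _ A)// => x /sA ->; ring.
Qed.

Lemma quad_ge0 A phi : supported A phi -> 0 <= quad q A phi phi.
Proof.
move=> sA; apply: le_trans (hardy_quad sA); apply: sumr_ge0 => x _.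
by rewrite mulr_ge0 ?(ltW (m_gt0 x))// mulr_ge0 ?sqr_ge0.
Qed.

Variables (g : X -> R) (gamma : R).
Hypotheses (g_ge0 : forall x, 0 <= g x) (gamma_gt0 : 0 < gamma) (gamma_lt1 : gamma < 1).
Hypothesis grad_g : forall x,
  (grad2 m b (fun y => Num.sqrt (g y)) x <= (gamma * g x * w x)%:E)%E.

Let G x := Num.sqrt (g x).

Let sqrG x : G x ^+ 2 = g x.
Proof. exact: sqr_sqrtr. Qed.

Lemma sum_grad_sqrt_le x A :
  \sum_(y <- A) b x y * (G x - G y) ^+ 2 <= 2 * gamma * g x * w x * m x.
Proof.
have := grad_g x; rewrite /grad2 => Gx.
have m2 : 0 < 2 * m x by rewrite mulr_gt0.
have : (((2 * m x)^-1)%:E * \sum_(y <- A) (b x y * (G x - G y) ^+ 2)%:E <=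
    (gamma * g x * w x)%:E)%E.
  apply: (le_trans _ Gx); apply: lee_wpmul2l; last exact: sum_le_esum.
  by rewrite lee_fin invr_ge0 ltW.
rewrite sumEFin -EFinM lee_fin ler_pdivrMl// => /le_trans; apply.
by rewrite le_eqVlt; apply/orP; left; apply/eqP; ring.
Qed.

Variable f : X -> R.
Hypothesis supp_f : forall x, f x != 0 -> 0 < w x.

(** The end of the argument common to both cases. Young's inequality
    [f psi <= c / 2 * psi^2 w + f^2 / (2 c w)] absorbs half of the left-hand side. Pointwise
    convergence suffices because the limit is taken on a fixed finite set [B] before the supremum
    over [B]. The freedom in [f_] leaves room for a cutoff factor. *)
Lemma rellich_of_approx u (psi_ f_ : nat -> X -> R) :
  (forall x, psi_ n x @[n --> \oo] --> u x) ->
  (forall n x, `|f_ n x| <= `|f x|) ->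
  (forall c, 0 < c -> c < 1 - gamma -> forall e, 0 < e -> \forall n \near \oo,
     exists2 A, supported A (psi_ n) &
       c * \sum_(x <- A) psi_ n x ^+ 2 * g x * w x * m x
       <= \sum_(x <- A) f_ n x * psi_ n x * g x * m x + e) ->
  (((1 - gamma) ^+ 2)%:E
     * (\esum_(x in [set: X]) (`|u x| ^+ 2 * g x * w x * m x)%:E)
   <= \esum_(x in [set: X]) (`|f x| ^+ 2 * g x * (w x)^-1 * m x)%:E)%E.
Proof.
move=> psiu f_le approx.
have F_ge0 x : 0 <= `|f x| ^+ 2 * g x * (w x)^-1 * m x.
  by rewrite mulr_ge0 ?(ltW (m_gt0 x))// mulr_ge0 ?invr_ge0// mulr_ge0 ?sqr_ge0.
have U_ge0 v x : 0 <= v x ^+ 2 * g x * w x * m x.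
  by rewrite mulr_ge0 ?(ltW (m_gt0 x))// mulr_ge0// mulr_ge0 ?sqr_ge0.
set F := (X in (_ <= X)%E).
have [->|Foo] := eqVneq F +oo%E; first by rewrite leey.
have /fineK FE : F \is a fin_num.
  rewrite ge0_fin_numE ?lt_neqAle ?Foo ?leey//.
  by apply: esum_ge0 => x _; rewrite lee_fin.
rewrite -FE; set r := fine F.
have Fr A : \sum_(x <- A) `|f x| ^+ 2 * g x * (w x)^-1 * m x <= r.
  by rewrite -lee_fin FE -sumEFin; exact: sum_le_esum.
have bound c : 0 < c -> c < 1 - gamma -> forall B,
    c ^+ 2 * \sum_(x <- B) u x ^+ 2 * g x * w x * m x <= r.
  move=> c0 cg B; apply/ler_addgt0Pr => e e0.
  (* After absorption, [c / 2] times the sum is at most [r / (2 * c)] plus the error; multiplying by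
     [2 * c] turns this error into [e]. *)
  have e'0 : 0 < e / (2 * c) by rewrite divr_gt0// mulr_gt0.
  have cvgB : \sum_(x <- B) psi_ n x ^+ 2 * g x * w x * m x @[n --> \oo] -->
      \sum_(x <- B) u x ^+ 2 * g x * w x * m x.
    apply: cvg_big => [|x _]; first exact: add_continuous.
    do 3 apply: cvgMr_tmp; exact: cvgM.
  have ccvgB : c ^+ 2 * \sum_(x <- B) psi_ n x ^+ 2 * g x * w x * m x @[n --> \oo] -->
      c ^+ 2 * \sum_(x <- B) u x ^+ 2 * g x * w x * m x by exact: cvgMl_tmp.
  apply: (cvg_le ccvgB (cvg_cst (r + e))).
  have := approx c c0 cg _ e'0; apply: filterS => n [A sA] An.
  have BA : \sum_(x <- B) psi_ n x ^+ 2 * g x * w x * m x <=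
      \sum_(x <- A) psi_ n x ^+ 2 * g x * w x * m x.
    rewrite -(sum_supp (fsubsetUl A B)); last by move=> x /sA ->; ring.
    exact: le_sum_subset (fsubsetUr A B).
  have fA : \sum_(x <- A) f_ n x * psi_ n x * g x * m x <=
    c / 2 * (\sum_(x <- A) psi_ n x ^+ 2 * g x * w x * m x) + (2 * c)^-1 * r.
    apply: le_trans (lerD (lexx _) (ler_wpM2l _ (Fr A))); last first.
      by rewrite invr_ge0 mulr_ge0// ltW.
    rewrite !mulr_sumr -big_split/=; apply: ler_sum => x _.
    (* Where [f] vanishes so does [f_ n], and no division by [w] is involved; elsewhere [w x] is
       positive. *)
    have [fx0|fx0] := eqVneq (f x) 0.
      have : `|f_ n x| <= 0 by rewrite (le_trans (f_le n x))// fx0 normr0.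
      rewrite normr_le0 => /eqP ->; rewrite fx0 normr0.
      have := U_ge0 (psi_ n) x; set t := (X in 0 <= X) => t0.
      by rewrite expr0n/= !mul0r mulr0 addr0 mulr_ge0// divr_ge0// ltW.
    have wx := supp_f fx0.
    have -> : c / 2 * (psi_ n x ^+ 2 * g x * w x * m x)
        + (2 * c)^-1 * (`|f x| ^+ 2 * g x * (w x)^-1 * m x)
      = (c / 2 * (psi_ n x ^+ 2 * w x) + (2 * c)^-1 * (`|f x| ^+ 2 * (w x)^-1))
        * (g x * m x).
      by ring.
    rewrite -(mulrA _ (g x)); apply: ler_wpM2r.
      by rewrite mulr_ge0// ltW.
    have fsq : f_ n x ^+ 2 <= `|f x| ^+ 2.
      by rewrite -(real_normK (num_real (f_ n x))) lerXn2r ?nnegrE//.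
    apply: le_trans (lerD (lexx _) (ler_wpM2l _ (ler_wpM2r _ fsq))); last 2 first.
    - by rewrite invr_ge0 mulr_ge0// ltW.
    - by rewrite invr_ge0.
    rewrite -subr_ge0 (_ : _ - _ = (2 * c * w x)^-1 * (c * w x * psi_ n x - f_ n x) ^+ 2).
      by rewrite mulr_ge0 ?sqr_ge0// invr_ge0 mulr_ge0// mulr_ge0// ltW.
    by field; rewrite !lt0r_neq0.
  have An' : c * (c / 2 * \sum_(x <- A) psi_ n x ^+ 2 * g x * w x * m x)
      <= c * ((2 * c)^-1 * r + e / (2 * c)).
    by apply: ler_wpM2l; [exact: ltW | lra].
  have cc : c * ((2 * c)^-1 * r + e / (2 * c)) = (r + e) / 2 by field; exact: lt0r_neq0.
  rewrite cc in An'.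
  have := ler_wpM2l (sqr_ge0 c) BA; lra.
have bound1 B : (1 - gamma) ^+ 2 * \sum_(x <- B) u x ^+ 2 * g x * w x * m x <= r.
  set S := \sum_(x <- B) _; have d0 : 0 < 1 - gamma by rewrite subr_gt0.
  (* The bound is available only for [c] strictly between 0 and [1 - gamma], so the endpoint is
     reached as a limit. *)
  have cv : (1 - gamma - n.+1%:R^-1 : R) @[n --> \oo] --> 1 - gamma.
    rewrite -[X in _ --> X]subr0; apply: cvgB; first exact: cvg_cst.
    exact: cvg_harmonic.
  have cvS : (1 - gamma - n.+1%:R^-1) ^+ 2 * S @[n --> \oo] --> (1 - gamma) ^+ 2 * S.
    by apply: cvgMr_tmp; exact: cvgM.
  apply: (cvg_le cvS (cvg_cst r)).
  near=> n; apply: (bound _ _ _ B).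
    near: n; exact: (cvgr_gt _ cv).
  by rewrite ltrBlDr ltrDl invr_gt0.
have d2 : 0 < (1 - gamma) ^+ 2 by rewrite exprn_gt0// subr_gt0.
rewrite -lee_pdivlMl//; apply: esum_le => A; rewrite sumEFin -EFinM lee_fin.
rewrite ler_pdivlMl// (le_trans _ (bound1 A))//; apply: ler_wpM2l; first exact: ltW.
by apply: ler_sum => x _; rewrite real_normK ?num_real.
Unshelve. all: by end_near. Qed.

(** * Case (a): cutoffs of an approximable function *)

Lemma sqr_gradM_le (beta p r s t : R) : gamma < beta ->
  (p * s - r * t) ^+ 2 <=
    beta / gamma * (p ^+ 2 * (s - t) ^+ 2)
    + beta / (beta - gamma) * (t ^+ 2 * (p - r) ^+ 2).
Proof.
move=> gb; have bg0 : 0 < beta - gamma by rewrite subr_gt0.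
(* Since [p * s - r * t = p * (s - t) + t * (p - r)], this is the weighted bound on the square of a
   sum; the reciprocals of the two weights add up to 1. The weight [beta / gamma] turns the constant
   [gamma] of the gradient bound into [beta]. *)
rewrite -subr_ge0 (_ : _ - _ = (gamma * (beta - gamma))^-1 *
    ((beta - gamma) * (p * (s - t)) - gamma * (t * (p - r))) ^+ 2).
  by rewrite mulr_ge0 ?sqr_ge0// invr_ge0 mulr_ge0// ltW.
by field; rewrite !lt0r_neq0.
Qed.

(** By the product rule, the gradient of [G] contributes a multiple [beta] of the Hardy term, and
    the gradient of the cutoff contributes an error proportional to [a]. *)
Lemma sum_grad_cutoff_le A phi v M a beta : gamma < beta ->
  supported A phi -> 0 < M -> (forall x, g x <= M) ->
  (\esum_(x in [set: X]) ((v x ^+ 2)%:E * grad2 m b phi x * (m x)%:E) <= a%:E)%E ->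
  forall B, (A `<=` B)%fset ->
  2^-1 * (\sum_(x <- B) v x ^+ 2 *
     \sum_(y <- B) b x y * (phi x * G x - phi y * G y) ^+ 2) <=
  beta * (\sum_(x <- A) (v x * phi x) ^+ 2 * g x * w x * m x)
  + beta / (beta - gamma) * M * a.
Proof.
move=> gb sA M0 gM va B AB.
have bg0 : 0 < beta - gamma by rewrite subr_gt0.
have beta0 : 0 < beta by exact: lt_trans gb.
have {va} va : \sum_(x <- B)
    v x ^+ 2 * (2^-1 * \sum_(y <- B) b x y * (phi x - phi y) ^+ 2) <= a.
  rewrite -lee_fin; apply: (le_trans _ va); apply: (le_trans _ (sum_le_esum _ B)).
  rewrite -sumEFin; apply: lee_sum => x _.
  have phix := has_sum_sqdiff graph_b (x := x) sA.
  rewrite (grad2_has_sum m graph_b phix) -!EFinM lee_fin -mulrA.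
  apply: ler_wpM2l; first exact: sqr_ge0.
  set S := (X in _ <= (2 * m x)^-1 * X * _).
  rewrite (_ : _ * S * _ = 2^-1 * S); last by field; rewrite lt0r_neq0.
  apply: ler_wpM2l; first by rewrite invr_ge0.
  by apply: sum_le_has_sum phix => y; rewrite mulr_ge0 ?sqr_ge0.
have bM0 : 0 <= beta / (beta - gamma) * M.
  by rewrite mulr_ge0 ?(ltW M0)// divr_ge0 ?(ltW beta0) ?(ltW bg0).
apply: le_trans (lerD (lexx _) (ler_wpM2l bM0 va)).
rewrite -(sum_supp AB); last by move=> x /sA ->; ring.
rewrite !mulr_sumr -big_split/=; apply: ler_sum => x _.
set P := \sum_(y <- B) b x y * (phi x - phi y) ^+ 2.
have P0 : 0 <= P by apply: sumr_ge0 => y _; rewrite mulr_ge0 ?sqr_ge0.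
set Q := \sum_(y <- B) _.
have QP : Q <= beta / gamma * phi x ^+ 2 * (2 * gamma * g x * w x * m x)
    + beta / (beta - gamma) * M * P.
  apply: le_trans (lerD (ler_wpM2l _ (sum_grad_sqrt_le x B)) (lexx _)); last first.
    by rewrite mulr_ge0 ?sqr_ge0// divr_ge0// ltW.
  rewrite /Q /P !mulr_sumr -big_split/=; apply: ler_sum => y _.
  apply: (le_trans (ler_wpM2l (b_ge0 x y) (sqr_gradM_le _ _ _ _ gb))).
  rewrite mulrDr lerD//; first by rewrite le_eqVlt; apply/orP; left; apply/eqP; ring.
  (* The factor [G y ^+ 2 = g y] sits at the neighbour [y], where it is estimated by [M]. *)
  rewrite [leLHS](_ : _ = beta / (beta - gamma) * G y ^+ 2
    * (b x y * (phi x - phi y) ^+ 2)); last by ring.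
  apply: ler_wpM2r; first by rewrite mulr_ge0 ?sqr_ge0.
  by rewrite sqrG; apply: ler_wpM2l => //; rewrite divr_ge0// ltW.
have := ler_wpM2l (sqr_ge0 (v x)) QP => vQP.
rewrite (_ : _ + _ = 2^-1 * (v x ^+ 2 *
    (beta / gamma * phi x ^+ 2 * (2 * gamma * g x * w x * m x)
     + beta / (beta - gamma) * M * P))).
  by apply: ler_wpM2l => //; rewrite invr_ge0.
by field; rewrite !lt0r_neq0.
Qed.

Lemma cvge0_near_le (h : nat -> \bar R) a : 0 < a ->
  h n @[n --> \oo] --> 0%E -> \forall n \near \oo, (h n <= a%:E)%E.
Proof.
move=> a0 h0.
have : \forall n \near \oo, (h n < a%:E)%E.
  have /= N0 := nbhs_open_ereal_lt (f := fun=> a) a0.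
  exact: (h0 _ N0).
by apply: filterS => n /ltW.
Qed.

Hypothesis g_bounded : exists2 M, 0 < M & forall x, g x <= M.

Lemma rellich_approximable u : approximable m b u ->
  solution m b q u f \/ pos_subsolution m b q u f ->
  (((1 - gamma) ^+ 2)%:E
     * (\esum_(x in [set: X]) (`|u x| ^+ 2 * g x * w x * m x)%:E)
   <= \esum_(x in [set: X]) (`|f x| ^+ 2 * g x * (w x)^-1 * m x)%:E)%E.
Proof.
move=> [udom [phi [Cphi phi0 phi_nd phi1 phi_grad]]] u_sol.
have [M M0 gM] := g_bounded.
have phi_le1 n x : phi n x <= 1.
  apply: (cvg_le (cvg_cst _) (phi1 x)); exists n => // k /= nk.
  by move/nondecreasing_seqP : (fun n => phi_nd n x) => /(_ _ _ nk).
(* For a subsolution, [u >= 0] is what permits multiplying the inequality by [u]. *)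
have u_lap x p : u x * p ^+ 2 * laplace m b q u x <= f x * u x * p ^+ 2 * m x.
  rewrite -(formal_opE m_gt0 graph_b q _ udom).
  rewrite (_ : _ * _ * _ = u x * formal_op m b q u x * (p ^+ 2 * m x)); last by ring.
  rewrite -(mulrA _ (p ^+ 2)); apply: ler_wpM2r; first by rewrite mulr_ge0 ?sqr_ge0 ?ltW.
  case: u_sol => [[_ ->]|[_ u0 uf]]; first by rewrite mulrC.
  by rewrite mulrC; apply: ler_wpM2r.
apply: (rellich_of_approx (psi_ := fun n x => u x * phi n x)
  (f_ := fun n x => f x * phi n x)).
- move=> x; rewrite -[X in _ --> X]mulr1; exact: cvgMl_tmp.
- by move=> n x; rewrite normrM ler_piMr// ger0_norm.
move=> c c0 cg e e0.
(* With [beta = 1 - c], subtracting the absorbed part from the Hardy term leaves the factor [c]. [K]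
   is the resulting constant of the cutoff error, so cutoff energy [e / K] costs [e]. *)
have gb : gamma < 1 - c by lra.
pose K := (1 - c) / (1 - c - gamma) * M.
have c1 : 0 < 1 - c by exact: lt_trans gb.
have K0 : 0 < K by rewrite mulr_gt0// divr_gt0// subr_gt0.
have a0 : 0 < e / K by rewrite divr_gt0.
have := cvge0_near_le a0 phi_grad; apply: filterS => n na.
have [A sA] := Cc_supported (Cphi n).
have sAG : supported A (phi n \* G) by move=> x /sA /= ->; rewrite mul0r.
exists A; first by move=> x /sA ->; rewrite mulr0.
have := quad_mul_le m graph_b q udom sAG (sum_grad_cutoff_le gb sA M0 gM na).
have sAu : supported A (u \* (phi n \* G)) by move=> x /sAG /= ->; rewrite mulr0.
have := hardy_quad sAu.
have -> : \sum_(x <- A) w x * (u \* (phi n \* G)) x ^+ 2 * m x =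
  \sum_(x <- A) (u x * phi n x) ^+ 2 * g x * w x * m x.
  by apply: eq_bigr => x _ /=; rewrite -sqrG; ring.
have : \sum_(x <- A) u x * (phi n \* G) x ^+ 2 * laplace m b q u x <=
  \sum_(x <- A) f x * phi n x * (u x * phi n x) * g x * m x.
  apply: ler_sum => x _; apply: (le_trans (u_lap x _)).
  by rewrite /= -sqrG le_eqVlt; apply/orP; left; apply/eqP; ring.
rewrite -/K (mulrC K) divfK ?gt_eqF//.
lra.
Qed.

(** * Estimates in the form norm on finitely supported functions *)

Lemma quad_linear A p phi psi1 psi2 c d :
  quad p A phi (fun x => c * psi1 x + d * psi2 x)
  = c * quad p A phi psi1 + d * quad p A phi psi2.
Proof.
rewrite /form_on !mulrBr addrACA -opprD !mulr_sumr -!big_split/=.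
congr (_ - _); first by apply: eq_bigr => x _; ring.
apply: eq_bigr => x _; rewrite !mulr_sumr -big_split/=.
by apply: eq_bigr => y _; ring.
Qed.

Lemma quad_expand A p phi psi c d :
  quad p A (fun x => c * phi x + d * psi x) (fun x => c * phi x + d * psi x)
  = c ^+ 2 * quad p A phi phi + 2 * c * d * quad p A phi psi
    + d ^+ 2 * quad p A psi psi.
Proof.
rewrite quad_linear !(quad_sym _ graph_b _ _ (fun x => c * phi x + d * psi x)).
by rewrite !quad_linear (quad_sym _ graph_b _ _ psi phi); ring.
Qed.

Lemma quad_potential A p p' phi :
  quad (p \+ p') A phi phi = quad p A phi phi + \sum_(x <- A) p' x * phi x ^+ 2 * m x.
Proof.
rewrite /form_on addrAC -big_split/=; congr (_ - _).
by apply: eq_bigr => x _; rewrite /diag_coef/=; ring.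
Qed.

(** Nonnegativity of the form at [t * phi - psi], divided by [2 * t]. *)
Lemma quad_young A phi psi t : 0 < t -> supported A phi -> supported A psi ->
  quad q A phi psi <= t / 2 * quad q A phi phi + (2 * t)^-1 * quad q A psi psi.
Proof.
move=> t0 sphi spsi.
have : 0 <= quad q A (fun x => t * phi x + -1 * psi x) (fun x => t * phi x + -1 * psi x).
  by apply: quad_ge0 => x xA; rewrite sphi// spsi//; ring.
rewrite quad_expand => Q0; rewrite -subr_ge0.
rewrite (_ : _ - _ = (2 * t)^-1 * (t ^+ 2 * quad q A phi phi + 2 * t * -1 * quad q A phi psi
   + (-1) ^+ 2 * quad q A psi psi)); last by field; exact: lt0r_neq0.
by rewrite mulr_ge0// invr_ge0 mulr_ge0// ltW.
Qed.

Lemma sum_half_grad_le A B (C : {fset X}) phi : supported A phi ->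
  \sum_(x <- B) 2^-1 * \sum_(y <- C) b x y * (phi x - phi y) ^+ 2
  <= quad (fun=> 0) A phi phi.
Proof.
move=> sA.
have half_le x (D : {fset X}) : 2^-1 * (\sum_(y <- D) b x y * (phi x - phi y) ^+ 2)
    <= fine (grad2 m b phi x) * m x.
  have phix := has_sum_sqdiff graph_b (x := x) sA.
  rewrite (grad2_supp m_gt0 graph_b x sA); apply: ler_wpM2l; first by rewrite invr_ge0.
  apply: sum_le_has_sum phix => y.
  by rewrite mulr_ge0 ?sqr_ge0.
have := sum_le_has_sum B _ (has_sum_grad2 m_gt0 graph_b sA).
move=> H; apply: le_trans (H _); first by apply: ler_sum => x _; exact: half_le.
by move=> x; apply: le_trans (half_le x fset0); rewrite big_seq_fset0 mulr0.
Qed.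

(** The constant 1 is harmonic for the potential 0, so [quad_mul_le] with [v = 1] reduces the energy
    of [g \* phi] to finite gradient sums. The product rule then applies, with
    [g x - g y = (G x - G y) * (G x + G y)] and [(G x + G y) ^+ 2 <= 4 * M]. *)
Lemma quad0_mul_le A phi M : 0 < M -> (forall x, g x <= M) -> supported A phi ->
  quad (fun=> 0) A (g \* phi) (g \* phi) <=
  2 * M ^+ 2 * quad (fun=> 0) A phi phi
  + 8 * M ^+ 2 * gamma * \sum_(x <- A) w x * phi x ^+ 2 * m x.
Proof.
move=> M0 gM sA; set T := (X in _ <= X).
have sgA : supported A (g \* phi) by move=> x /sA /= ->; rewrite mulr0.
have dom1 : formal_dom b (fun=> 1).
  move=> x; under eq_esum do rewrite normr1 mulr1.
  exact: graph_summable.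
have lap1 x : laplace m b (fun=> 0) (fun=> 1) x = 0.
  rewrite /laplace /diag_coef mul0r addr0 mulr1.
  have : has_sum (b x) (asum (fun y => b x y * 1)).
    rewrite [X in has_sum X](_ : _ = fun y => b x y * 1); first exact: formal_dom_has_sum.
    by apply/funext => y; rewrite mulr1.
  by move=> /(has_sum_unique (has_sum_deg graph_b (x := x))) <-; rewrite subrr.
have := @quad_mul_le _ _ m _ graph_b (fun=> 0) A (fun=> 1) (g \* phi) T dom1 sgA.
rewrite big1; last by move=> x _; rewrite lap1 mulr0.
rewrite add0r (_ : (fun=> 1) \* (g \* phi) = g \* phi); last first.
  by apply/funext => x /=; rewrite mul1r.
apply => B AB.
have := sum_half_grad_le B B sA; set E := (X in X <= _) => Eq0.
apply: (@le_trans _ _ (2 * M ^+ 2 * E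
  + \sum_(x <- A) 8 * M ^+ 2 * gamma * (w x * phi x ^+ 2 * m x))); last first.
  rewrite /T [X in _ <= _ + X]mulr_sumr lerD2r; apply: ler_wpM2l Eq0.
  by rewrite mulr_ge0 ?sqr_ge0.
rewrite -(sum_supp AB); last by move=> x /sA ->; ring.
rewrite /E !mulr_sumr -big_split/=; apply: ler_sum => x _.
rewrite expr1n mul1r.
have gx := sum_grad_sqrt_le x B.
apply: (@le_trans _ _ (2 * M ^+ 2 * (2^-1 * \sum_(y <- B) b x y * (phi x - phi y) ^+ 2)
  + 4 * M * phi x ^+ 2 * (\sum_(y <- B) b x y * (G x - G y) ^+ 2))).
  rewrite !mulr_sumr -big_split/=; apply: ler_sum => y _.
  rewrite [leRHS](_ : _ = b x y * (M ^+ 2 * (phi x - phi y) ^+ 2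
    + 4 * M * phi x ^+ 2 * (G x - G y) ^+ 2)); last by field.
  rewrite mulrCA; apply: ler_wpM2l => //.
  apply: (@le_trans _ _ ((g y) ^+ 2 * (phi x - phi y) ^+ 2 + phi x ^+ 2 * (g x - g y) ^+ 2)).
    rewrite -subr_ge0 [leRHS](_ : _ =
      2^-1 * (g y * (phi x - phi y) - phi x * (g x - g y)) ^+ 2); last by field.
    by rewrite mulr_ge0 ?sqr_ge0 ?invr_ge0.
  apply: lerD.
    by apply: ler_wpM2r; rewrite ?sqr_ge0// lerXn2r ?nnegrE// ltW.
  rewrite [leRHS](_ : _ = phi x ^+ 2 * (4 * M * (G x - G y) ^+ 2)); last by ring.
  apply: ler_wpM2l; first exact: sqr_ge0.
  rewrite -2!sqrG subr_sqr exprMn mulrC; apply: ler_wpM2r; first exact: sqr_ge0.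
  apply: (@le_trans _ _ (2 * g x + 2 * g y)); last by have := gM x; have := gM y; lra.
  rewrite -2!sqrG -subr_ge0 (_ : _ - _ = (G x - G y) ^+ 2) ?sqr_ge0//; ring.
rewrite lerD2l [leRHS](_ : _ = 4 * M * phi x ^+ 2 * (2 * gamma * M * w x * m x)); last by ring.
apply: ler_wpM2l; first by rewrite mulr_ge0 ?sqr_ge0// mulr_ge0// ltW.
apply: (le_trans gx); apply: ler_wpM2r; first exact: ltW.
apply: ler_wpM2r => //.
by apply: ler_wpM2l => //; rewrite mulr_ge0// ltW.
Qed.

Lemma quad_le A (p p' : X -> R) phi : (forall x, p x <= p' x) ->
  quad p A phi phi <= quad p' A phi phi.
Proof.
move=> pp'; have -> : p' = p \+ (fun x => p' x - p x) by apply/funext => x /=; ring.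
rewrite quad_potential lerDl; apply: sumr_ge0 => x _.
by rewrite mulr_ge0 ?(ltW (m_gt0 x))// mulr_ge0 ?sqr_ge0// subr_ge0.
Qed.

(* [q \+ cst 1] turns the quadratic form into the square of the form norm,
   [h(phi) + ||phi||^2]. *)
Local Notation fnorm A phi := (quad (q \+ cst 1) A phi phi).

Lemma fnormE A phi :
  fnorm A phi = quad q A phi phi + \sum_(x <- A) phi x ^+ 2 * m x.
Proof.
by rewrite quad_potential; congr (_ + _); apply: eq_bigr => x _ /=; rewrite mul1r.
Qed.

Lemma sqr_mass_ge0 A phi : 0 <= \sum_(x <- A) phi x ^+ 2 * m x.
Proof. by apply: sumr_ge0 => x _; rewrite mulr_ge0 ?sqr_ge0 ?ltW. Qed.

Lemma quad_le_fnorm A phi : quad q A phi phi <= fnorm A phi.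
Proof. by rewrite fnormE lerDl sqr_mass_ge0. Qed.

Lemma fnorm_ge0 A phi : supported A phi -> 0 <= fnorm A phi.
Proof. by move=> /quad_ge0/le_trans; apply; exact: quad_le_fnorm. Qed.

Lemma fnormB_le A phi psi : supported A phi -> supported A psi ->
  fnorm A phi <= 2 * fnorm A (phi \- psi) + 2 * fnorm A psi.
Proof.
move=> sphi spsi.
(* The right-hand side minus the left-hand side is the form norm squared of [phi - 2 psi]. *)
have : 0 <= fnorm A (fun x => 1 * phi x + -2 * psi x).
  by apply: fnorm_ge0 => x xA; rewrite sphi// spsi//; ring.
have -> : phi \- psi = fun x => 1 * phi x + -1 * psi x by apply/funext => x /=; ring.
by rewrite !quad_expand; lra.
Qed.

Hypothesis q_V : classV m b q.

(** The form with potential [q^\+] is [h] plus the sum of [q^\- phi^2 m]. Absorbing the latter by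
    the inequality of the class V leaves [eps] times that form below [h(phi) + C ||phi||^2]. *)
Lemma quad_pos_le : exists2 K, 0 < K &
  forall A phi, supported A phi -> quad q^\+ A phi phi <= K * fnorm A phi.
Proof.
have [eps [C [eps0 C0 qV]]] := q_V.
exists ((1 + C) / eps) => [|A phi sA]; first by rewrite divr_gt0// addr_gt0.
have := qV phi (supported_Cc sA).
rewrite (form_supp m_gt0 graph_b _ sA) !(@asum_supp _ _ _ A); last 2 first.
- by move=> x /sA ->; ring.
- by move=> x /sA ->; ring.
have qE : q^\+ = q \+ q^\-.
  by apply/funext => x /=; rewrite -{2}(funrposBneg q) /= subrK.
have := quad_potential A q q^\- phi; rewrite -qE => -> qV1.
have Q0 := quad_ge0 sA; have M0 := sqr_mass_ge0 A phi; rewrite fnormE.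
set Q := quad q A phi phi in Q0 qV1 *; set N := \sum_(x <- A) phi x ^+ 2 * m x in qV1 M0 *.
set S := \sum_(x <- A) _ in qV1 *.
rewrite mulrAC ler_pdivlMr// mulrC.
have := mulr_ge0 (ltW C0) Q0; nra.
Qed.

(** The potential is first raised to [q^\+]. Multiplication by [g] then costs at most [M ^+ 2] on
    the potential part and [quad0_mul_le] on the gradient part; [quad_pos_le] and Hardy's inequality
    return to the form norm. *)
Lemma fnorm_mul_le : exists2 L, 0 < L & forall A phi, supported A phi ->
  quad q A (g \* phi) (g \* phi) <= L * fnorm A phi.
Proof.
have [M M0 gM] := g_bounded; have [K K0 qK] := quad_pos_le.
exists (2 * M ^+ 2 * K + 8 * M ^+ 2 * gamma) => [|A phi sA].
  by rewrite addr_gt0// !mulr_gt0// exprn_gt0.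
have qE : q^\+ = (fun=> 0) \+ q^\+ by apply/funext => x /=; rewrite add0r.
apply: (@le_trans _ _ (quad q^\+ A (g \* phi) (g \* phi))).
  by apply: quad_le => x; rewrite -{1}(funrposBneg q) gerBl funrneg_ge0.
have := quad_potential A (fun=> 0) q^\+ (g \* phi); rewrite -qE => ->.
have H1 := quad0_mul_le M0 gM sA.
have H2 := qK _ _ sA.
have H3 := le_trans (hardy_quad sA) (quad_le_fnorm _ _).
have := quad_potential A (fun=> 0) q^\+ phi; rewrite -qE => qpE; rewrite qpE in H2.
have H4 : \sum_(x <- A) q^\+ x * (g \* phi) x ^+ 2 * m x <=
    M ^+ 2 * \sum_(x <- A) q^\+ x * phi x ^+ 2 * m x.
  rewrite mulr_sumr; apply: ler_sum => x _ /=.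
  rewrite exprMn (_ : _ * m x = g x ^+ 2 * (q^\+ x * phi x ^+ 2 * m x)); last by ring.
  apply: ler_wpM2r; last by rewrite lerXn2r ?nnegrE// ltW.
  by rewrite mulr_ge0 ?(ltW (m_gt0 x))// mulr_ge0 ?sqr_ge0// funrpos_ge0.
have H5 : 0 <= \sum_(x <- A) q^\+ x * phi x ^+ 2 * m x.
  apply: sumr_ge0 => x _.
  by rewrite mulr_ge0 ?(ltW (m_gt0 x))// mulr_ge0 ?sqr_ge0// funrpos_ge0.
have MM : 0 <= M ^+ 2 by exact: sqr_ge0.
have H6 := mulr_ge0 MM H5.
have H7 := ler_wpM2l MM H2.
have Mg : 0 <= 8 * M ^+ 2 * gamma by rewrite !mulr_ge0// ltW.
have H8 := ler_wpM2l Mg H3.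
lra.
Qed.

(** Since [phi y ^+ 2 <= 2 * (phi x - phi y) ^+ 2 + 2 * phi x ^+ 2], the energy of the edges at [x]
    and the mass at [x] control all neighbours of [x]. *)
Lemma local_fnorm_le x : exists2 K, 0 < K & forall A B phi, supported A phi ->
  \sum_(y <- B) b x y * phi y ^+ 2 <= K * fnorm A phi.
Proof.
have [K K0 qK] := quad_pos_le.
have dx : 0 <= deg b x / m x by rewrite divr_ge0 ?deg_ge0// ltW.
exists (4 * K + 2 * (deg b x / m x)) => [|A B phi sA].
  by apply: ltr_wpDr; [exact: mulr_ge0 | exact: mulr_gt0].
have H1 : 2^-1 * (\sum_(y <- B) b x y * (phi x - phi y) ^+ 2) <= K * fnorm A phi.
  apply: le_trans (qK _ _ sA).
  apply: (@le_trans _ _ (quad (fun=> 0) A phi phi)); last first.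
    by apply: quad_le => y; rewrite funrpos_ge0.
  by have := sum_half_grad_le [fset x]%fset B sA; rewrite big_seq_fset1.
have H2 : phi x ^+ 2 <= fnorm A phi / m x.
  rewrite ler_pdivlMr//; apply: (@le_trans _ _ (\sum_(y <- A) phi y ^+ 2 * m y)).
    have [xA|/sA ->] := boolP (x \in A); last by rewrite expr0n mul0r sqr_mass_ge0.
    rewrite (big_fsetD1 x)//= lerDl sqr_mass_ge0//.
  by rewrite fnormE lerDr quad_ge0.
have H3 : \sum_(y <- B) b x y <= deg b x.
  exact: sum_le_has_sum (has_sum_deg graph_b (x := x)).
apply: (@le_trans _ _ (4 * (2^-1 * (\sum_(y <- B) b x y * (phi x - phi y) ^+ 2))
   + 2 * (phi x ^+ 2 * \sum_(y <- B) b x y))).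
  rewrite !mulr_sumr -big_split/=; apply: ler_sum => y _.
  rewrite -subr_ge0 (_ : _ - _ = b x y * (2 * phi x - phi y) ^+ 2); last by field.
  by rewrite mulr_ge0 ?sqr_ge0.
rewrite [leRHS]mulrDl; apply: lerD; first by rewrite -mulrA ler_wpM2l.
rewrite (_ : _ * fnorm A phi = 2 * (fnorm A phi / m x * deg b x)); last by ring.
apply: ler_wpM2l => //; apply: ler_pM => //; first exact: sqr_ge0.
exact: sumr_ge0.
Qed.

(** * Case (b): approximation in the form norm *)

Section FormApprox.
Variables (u : X -> R) (phi : nat -> X -> R).
Hypothesis phi_u : form_approx m b q phi u.

Lemma form_approx_l2 a : 0 < a ->
  \forall n \near \oo, forall A, \sum_(x <- A) (phi n x - u x) ^+ 2 * m x <= a.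
Proof.
have [_ l2u _] := phi_u; move=> a0; have := cvge0_near_le a0 l2u.
apply: filterS => n na A; rewrite -lee_fin -sumEFin; apply: le_trans na.
exact: sum_le_esum.
Qed.

Lemma form_approx_cvg x : phi n x @[n --> \oo] --> u x.
Proof.
apply/cvgrPdist_le => e e0.
have e2 : 0 < e ^+ 2 * m x by rewrite mulr_gt0// exprn_gt0.
have := form_approx_l2 e2; apply: filterS => n /(_ [fset x]%fset).
rewrite big_seq_fset1 ler_pM2r// => le_e.
by rewrite distrC -(ger0_norm (ltW e0)) -ler_sqr ?nnegrE// !real_normK ?num_real.
Qed.

Lemma form_approx_cauchy e : 0 < e -> exists N, forall k l, (N <= k)%N -> (N <= l)%N ->
  forall A, supported A (phi k) -> supported A (phi l) ->
  fnorm A (phi k \- phi l) <= e.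
Proof.
move=> e0; have [_ _ form_cauchy] := phi_u.
(* The form part contributes [e / 2]; the mass part is at most twice the sum of two squared
   distances to [u], each at most [e / 8]. *)
have e2 : 0 < e / 2 by rewrite divr_gt0.
have e8 : 0 < e / 8 by rewrite divr_gt0.
have [[P Q] /= [[N1 _ N1P] [N2 _ N2Q]] PQ] := form_cauchy _ e2.
have [N3 _ N3e] := form_approx_l2 e8.
exists (maxn N1 (maxn N2 N3)) => k l; rewrite !geq_max.
move=> /and3P[N1k N2k N3k] /and3P[N1l N2l N3l] A sk sl.
have sA : supported A (phi k \- phi l) by move=> x xA; rewrite /= sk// sl// subrr.
have /= := PQ (k, l) (conj (N1P _ N1k) (N2Q _ N2l)).
rewrite (form_supp m_gt0 graph_b _ sA) => /ltW /(le_trans (ler_norm _)) H1.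
rewrite fnormE.
have : \sum_(x <- A) (phi k \- phi l) x ^+ 2 * m x <=
    2 * (\sum_(x <- A) (phi k x - u x) ^+ 2 * m x)
    + 2 * (\sum_(x <- A) (phi l x - u x) ^+ 2 * m x).
  rewrite !mulr_sumr -big_split/=; apply: ler_sum => x _.
  rewrite -subr_ge0 [leRHS](_ : _ = (phi k x + phi l x - 2 * u x) ^+ 2 * m x); last by ring.
  by rewrite mulr_ge0 ?sqr_ge0 ?ltW.
have := N3e _ N3k A; have := N3e _ N3l A; rewrite /=; lra.
Qed.

Lemma form_approx_bounded : exists N L, 0 < L /\ forall n, (N <= n)%N ->
  forall A, supported A (phi n) -> fnorm A (phi n) <= L.
Proof.
have [N HN] := form_approx_cauchy ltr01.
have [Cphi _ _] := phi_u.
have [B sB] := Cc_supported (Cphi N).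
exists N, (2 + 2 * fnorm B (phi N)); split.
  by rewrite ltr_pwDl// mulr_ge0// fnorm_ge0.
move=> n Nn A sA.
have AB := fsubsetUl A B; have BA := fsubsetUr A B.
(* Enlarging the finite set beyond the support leaves the form norm unchanged, so both functions can
   be compared on the union of their supports. *)
have fnorm_sub C D v : (C `<=` D)%fset -> supported C v -> fnorm D v = fnorm C v.
  move=> CD sC; rewrite !quad_laplace//; last exact: supported_sub sC.
  by apply: sum_supp => // x /sC ->; rewrite mul0r.
have sAB := supported_sub AB sA; have sBA := supported_sub BA sB.
have := fnormB_le sAB sBA.
rewrite (fnorm_sub _ _ _ AB sA) (fnorm_sub _ _ _ BA sB).
have := HN n N Nn (leqnn _) _ sAB sBA; lra.
Qed.

(** Gives pointwise convergence of [laplace q (phi n)] to [laplace q u]. The differences are small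
    in the [b x]-weighted square sum, hence in the weighted absolute sum because the degree is
    finite. *)
Lemma form_approx_local_cvg x : formal_dom b u ->
  asum (fun y => b x y * phi n y) @[n --> \oo] --> asum (fun y => b x y * u y).
Proof.
move=> udom; apply/cvgrPdist_le => e e0.
have [K K0 bK] := local_fnorm_le x.
have d0 : 0 < deg b x + 1 by rewrite ltr_wpDl// deg_ge0.
(* The Young parameter: [t / 2] times the degree and [(2 * t)^-1 * (t * e)] are each at most
   [e / 2]. The added 1 covers a vertex of degree 0. *)
pose t := e / (deg b x + 1).
have t0 : 0 < t by rewrite divr_gt0.
have a0 : 0 < t * e / K by rewrite !divr_gt0// mulr_gt0.
have [N HN] := form_approx_cauchy a0; have [Cphi _ _] := phi_u.
exists N => // n /= Nn.
have [A sA] := Cc_supported (Cphi n).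
(* Fatou's argument: the bound for [phi k - phi n] passes to the limit in [k] on each finite [B]. *)
have sqr_le B : \sum_(y <- B) b x y * (u y - phi n y) ^+ 2 <= t * e.
  have cv : \sum_(y <- B) b x y * (phi k y - phi n y) ^+ 2 @[k --> \oo] -->
      \sum_(y <- B) b x y * (u y - phi n y) ^+ 2.
    apply: cvg_big => [|y _]; first exact: add_continuous.
    apply: cvgMl_tmp; have cy : phi k y - phi n y @[k --> \oo] --> u y - phi n y.
      by apply: cvgB; [exact: form_approx_cvg | exact: cvg_cst].
    exact: cvgM.
  apply: (cvg_le cv (cvg_cst _)); exists N => // k /= Nk.
  have [A' sA'] := Cc_supported (Cphi k).
  have s1 := supported_sub (fsubsetUl A A') sA; have s2 := supported_sub (fsubsetUr A A') sA'.
  have s3 : supported (A `|` A')%fset (phi k \- phi n).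
    by move=> y yA; rewrite /= s1// s2// subrr.
  have := bK _ B _ s3; have := HN _ _ Nk Nn _ s2 s1.
  move=> /(ler_wpM2l (ltW K0)).
  have -> : K * (t * e / K) = t * e by rewrite mulrC divfK ?gt_eqF.
  by move=> H1 H2; apply: le_trans H1.
have phin : has_sum (fun y => b x y * phi n y) (asum (fun y => b x y * phi n y)).
  rewrite (@asum_supp _ _ _ A); last by move=> y /sA ->; rewrite mulr0.
  by apply: has_sum_supp => y /sA ->; rewrite mulr0.
have diff := has_sumB (formal_dom_has_sum graph_b (x := x) udom) phin.
apply: (cvg_le (cvg_norm diff) (cvg_cst e)); near=> B.
apply: (le_trans (ler_norm_sum _ _ _)).
apply: (@le_trans _ _ (t / 2 * (\sum_(y <- B) b x y) +
    (2 * t)^-1 * (\sum_(y <- B) b x y * (u y - phi n y) ^+ 2))).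
  rewrite !mulr_sumr -big_split/=; apply: ler_sum => y _.
  rewrite -mulrBr normrM ger0_norm//.
  rewrite [leRHS](_ : _ = b x y * (t / 2 + (2 * t)^-1 * (u y - phi n y) ^+ 2)); last by ring.
  apply: ler_wpM2l => //; rewrite -(real_normK (num_real (u y - phi n y))).
  set s := `|_|; rewrite -subr_ge0 [leRHS](_ : _ = (2 * t)^-1 * (t - s) ^+ 2).
    by rewrite mulr_ge0 ?sqr_ge0// invr_ge0 mulr_ge0// ltW.
  by field; rewrite lt0r_neq0.
have H1 : \sum_(y <- B) b x y <= deg b x.
  exact: sum_le_has_sum (has_sum_deg graph_b (x := x)).
have H2 : t / 2 * (\sum_(y <- B) b x y) <= e / 2.
  rewrite /t mulrAC ler_wpM2r ?invr_ge0// -mulrA ler_piMr ?(ltW e0)//.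
  by rewrite ler_pdivrMl// mulr1 (le_trans H1)// lerDl.
have H3 : (2 * t)^-1 * (\sum_(y <- B) b x y * (u y - phi n y) ^+ 2) <= e / 2.
  apply: (le_trans (ler_wpM2l _ (sqr_le B))); first by rewrite invr_ge0 mulr_ge0// ltW.
  by rewrite le_eqVlt; apply/orP; left; apply/eqP; field; rewrite lt0r_neq0.
lra.
Unshelve. all: by end_near. Qed.

Lemma rellich_form_approx : solution m b q u f ->
  (((1 - gamma) ^+ 2)%:E
     * (\esum_(x in [set: X]) (`|u x| ^+ 2 * g x * w x * m x)%:E)
   <= \esum_(x in [set: X]) (`|f x| ^+ 2 * g x * (w x)^-1 * m x)%:E)%E.
Proof.
move=> [udom uf]; have [Cphi _ _] := phi_u.
apply: (rellich_of_approx (psi_ := phi) (f_ := fun=> f)) => //.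
  exact: form_approx_cvg.
move=> c c0 cg e e0.
have [L L0 gL] := fnorm_mul_le.
have [N1 [L' [L'0 phiL]]] := form_approx_bounded.
have LL0 : 0 < L * L' by rewrite mulr_gt0.
(* Balances Young's inequality: the form norm squared [e / t] of [phi n - phi k] and the bound
   [L * L'] for [g \* phi n] contribute [e / 2] each. *)
pose t := L * L' / e.
have t0 : 0 < t by rewrite divr_gt0.
have et0 : 0 < e / t by rewrite divr_gt0.
have [N2 HN2] := form_approx_cauchy et0.
exists (maxn N1 N2) => // n /=; rewrite geq_max => /andP[N1n N2n].
have [A sA] := Cc_supported (Cphi n).
exists A => //.
have sgA : supported A (g \* phi n) by move=> x /sA /= ->; rewrite mulr0.
have lap_cvg : \sum_(x <- A) (g \* phi n) x * laplace m b q (phi k) x @[k --> \oo] -->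
    \sum_(x <- A) (g \* phi n) x * laplace m b q u x.
  apply: cvg_big => [|x _]; first exact: add_continuous.
  apply: cvgMl_tmp; apply: cvgB; last exact: form_approx_local_cvg.
  by apply: cvgMl_tmp; exact: form_approx_cvg.
have step1 : quad q A (phi n) (g \* phi n) <=
    \sum_(x <- A) (g \* phi n) x * laplace m b q u x + e.
  rewrite -lerBlDr; apply: (cvg_le (cvg_cst _) lap_cvg).
  exists N2 => // k /= N2k; rewrite lerBlDr.
  (* The index [n] stays fixed while [k] grows, so both functions are placed on a common finite set
     [C] that depends on [k]. *)
  have [A' sA'] := Cc_supported (Cphi k).
  set C := (A `|` A')%fset; have AC : (A `<=` C)%fset by exact: fsubsetUl.
  have s1 := supported_sub AC sA; have s2 := supported_sub (fsubsetUr A A') sA'.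
  have s3 := supported_sub AC sgA.
  have s4 : supported C (phi n \- phi k) by move=> y yA; rewrite /= s1// s2// subrr.
  have -> : quad q A (phi n) (g \* phi n) = quad q C (phi n) (g \* phi n).
    by rewrite !quad_laplace// (sum_supp AC)// => x /sgA ->; rewrite mul0r.
  have -> : \sum_(x <- A) (g \* phi n) x * laplace m b q (phi k) x =
      quad q C (phi k) (g \* phi n).
    by rewrite quad_laplace// (sum_supp AC)// => x /sgA ->; rewrite mul0r.
  have -> : quad q C (phi n) (g \* phi n) =
      quad q C (phi k) (g \* phi n) + quad q C (phi n \- phi k) (g \* phi n).
    rewrite !(quad_sym _ graph_b _ _ _ (g \* phi n)).
    rewrite (_ : phi n \- phi k = fun x => 1 * phi n x + -1 * phi k x).
      by rewrite quad_linear; ring.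
    by apply/funext => x /=; ring.
  rewrite lerD2l; apply: (le_trans (quad_young t0 s4 s3)).
  have H1 := le_trans (quad_le_fnorm _ _) (HN2 _ _ N2n N2k _ s1 s2).
  have H2 := le_trans (gL _ _ s1) (ler_wpM2l (ltW L0) (phiL _ N1n _ s1)).
  have H3 : t / 2 * quad q C (phi n \- phi k) (phi n \- phi k) <= e / 2.
    apply: (le_trans (ler_wpM2l _ H1)); first by rewrite divr_ge0// ltW.
    by rewrite le_eqVlt; apply/orP; left; apply/eqP; field; rewrite lt0r_neq0.
  have H4 : (2 * t)^-1 * quad q C (g \* phi n) (g \* phi n) <= e / 2.
    apply: (le_trans (ler_wpM2l _ H2)); first by rewrite invr_ge0 mulr_ge0// ltW.
    rewrite /t le_eqVlt; apply/orP; left; apply/eqP; field.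
    by rewrite !lt0r_neq0.
  lra.
have step2 : \sum_(x <- A) (g \* phi n) x * laplace m b q u x =
    \sum_(x <- A) f x * phi n x * g x * m x.
  apply: eq_bigr => x _; rewrite -(formal_opE m_gt0 graph_b q _ udom) uf /=; ring.
rewrite step2 in step1.
(* Here [phi n] itself takes the place of [v], and [G] that of the multiplier, so only the gradient
   of [G] appears and the absorbed constant is [gamma] itself. *)
have sGA : supported A (phi n \* G) by move=> x /sA /= ->; rewrite mul0r.
have hardy := hardy_quad sGA.
have mul_fin := quad_mul_fin m graph_b q A (phi n) G.
rewrite (_ : G \* G \* phi n = g \* phi n) in mul_fin; last first.
  by apply/funext => x /=; rewrite -sqrG expr2.
have hardyE : \sum_(x <- A) w x * (phi n \* G) x ^+ 2 * m x =
    \sum_(x <- A) phi n x ^+ 2 * g x * w x * m x.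
  by apply: eq_bigr => x _ /=; rewrite exprMn sqrG; ring.
rewrite hardyE in hardy.
have grad : 2^-1 * (\sum_(x <- A)
    phi n x ^+ 2 * \sum_(y <- A) b x y * (G x - G y) ^+ 2) <=
    gamma * \sum_(x <- A) phi n x ^+ 2 * g x * w x * m x.
  rewrite !mulr_sumr; apply: ler_sum => x _.
  have := ler_wpM2l (sqr_ge0 (phi n x)) (sum_grad_sqrt_le x A); lra.
set S := \sum_(x <- A) phi n x ^+ 2 * g x * w x * m x in hardy grad *.
have S0 : 0 <= S.
  apply: sumr_ge0 => x _.
  by rewrite mulr_ge0 ?(ltW (m_gt0 x))// mulr_ge0// mulr_ge0 ?sqr_ge0.
have : c * S <= (1 - gamma) * S by rewrite ler_wpM2r// ltW.
lra.
Qed.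

End FormApprox.

End Rellich.

(* X is countable by its type. The summand f^2 g w^-1 m vanishes where f does,
   whatever the value of w^-1. *)
Theorem theorem3p1 (R : realType) (X : countType) (infX : infinite_set [set: X])
  (m : X -> R) (m_gt0 : forall x, 0 < m x)
  (b : X -> X -> R) (graph_b : is_graph b)
  (q : X -> R)
  (w : X -> R) (w_ge0 : forall x, 0 <= w x) (h_ge_w : form_ge m b q w)
  (g : X -> R) (g_ge0 : forall x, 0 <= g x) (g_bounded : bounded_fun g)
  (gamma : R) (gamma_gt0 : 0 < gamma) (gamma_lt1 : gamma < 1)
  (grad_g : forall x,
     (grad2 m b (fun y => Num.sqrt (g y)) x <= (gamma * g x * w x)%:E)%E)
  (f : X -> R) (supp_f : forall x, f x != 0 -> 0 < w x)
  (u : X -> R)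
  (hu : (approximable m b u /\
           (solution m b q u f \/ pos_subsolution m b q u f))
        \/ [/\ classV m b q, op_dom m b q u & solution m b q u f]) :
  (((1 - gamma) ^+ 2)%:E
     * (\esum_(x in [set: X]) (`|u x| ^+ 2 * g x * w x * m x)%:E)
   <= \esum_(x in [set: X]) (`|f x| ^+ 2 * g x * (w x)^-1 * m x)%:E)%E.
Proof.
have g_le : exists2 M, 0 < M & forall x, g x <= M.
  have [M [_ gM]] := g_bounded.
  (* [bounded_fun] gives a bound for every constant strictly above [M]; this one is also
     positive. *)
  exists (`|M| + 1) => [|x]; first by rewrite ltr_wpDl.
  apply: le_trans (ler_norm _) _; apply: gM => //.
  by rewrite (le_lt_trans (ler_norm M))// ltrDl.
case: hu => [[u_appr u_sol]|[q_V [[_ [phi phi_u]] _] u_sol]].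
  exact: (rellich_approximable m_gt0 graph_b w_ge0 h_ge_w g_ge0 gamma_gt0 gamma_lt1
    grad_g supp_f g_le u_appr u_sol).
exact: (rellich_form_approx m_gt0 graph_b w_ge0 h_ge_w g_ge0 gamma_gt0 gamma_lt1
  grad_g supp_f g_le q_V phi_u u_sol).
Qed.
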